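(* Let $R_1$ be the class of functions $f:\mathbb R\to[-\infty,\infty]$ for which there exists a sequence $(\varphi_n)\subset R_0$ of step functions with $\varphi_n\nearrow f$ a.e., and for such $f$ put $\int f\,dx:=\lim_{n\to\infty}\int\varphi_n\,dx$. Then: (i) $\int f\,dx$ does not depend on the particular choice of the sequence $(\varphi_n)\subset R_0$ with $\varphi_n\nearrow f$. (ii) The integral on $R_1$ is an extension of the integral on $R_0$ (that is, $R_0\subset R_1$ and the two integrals agree on $R_0$). (iii) If $f,g\in R_1$ and $f\le g$ a.e., then $\int f\,dx\le\int g\,dx$. (iv) If $f,g\in R_1$ and $c$ is a nonnegative real number, then $cf$, $f+g$, $\min\{f,g\}$ and $\max\{f,g\}$ also belong to $R_1$, and $$\int cf\,dx=c\int f\,dx,\qquad \int (f+g)\,dx=\int f\,dx+\int g\,dx.$$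
   Context: A set $N\subset\mathbb R$ is a null set if for each $\varepsilon>0$ it has a countable cover by intervals of total length $<\varepsilon$; a property holds almost everywhere (a.e.) if it holds outside a null set. Functions equal a.e. are identified, and $f=g$, $f\le g$, $f_n\to f$, $f_n\nearrow f$ are understood a.e.; $f_n\nearrow f$ means that $f_n\le f_{n+1}$ for all $n$ and $f_n\to f$, a.e. A step function is a function of the form $\varphi=\sum_{i=1}^m c_i\chi_{I_i}$ with bounded intervals $I_i\subset\mathbb R$ and real numbers $c_i$; its integral is $\int\varphi\,dx:=\sum_{i=1}^m c_i|I_i|$, where $|I_i|$ is the length of $I_i$ (this does not depend on the representation). $R_0$ denotes the vector lattice of step functions (modulo a.e. equality). Functions in $R_1$ may take infinite values on non-null sets and integrals on $R_1$ may equal $+\infty$. Convention: $0\cdot(\pm\infty):=0$. *)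

(* Defs.v *)
From HB Require Import structures.
From mathcomp Require Export all_boot all_order all_algebra.
From mathcomp Require Export all_classical all_reals all_analysis.
Set Implicit Arguments.
Unset Strict Implicit.
Unset Printing Implicit Defensive.
Export Order.TTheory GRing.Theory Num.Theory.
Export numFieldNormedType.Exports.

Local Open Scope classical_set_scope.
Local Open Scope ring_scope.
Local Open Scope ereal_scope.

(* [wlength idfun] is the library's length of an interval: b - a for endpoints
   a <= b, 0 for the empty set and +oo for an unbounded interval. *)
Definition ilength (R : realType) (I : interval R) : \bar R :=
  wlength idfun [set` I].

(* Some of the intervals I n may be empty, so finite covers are included. *)
Definition null_set (R : realType) (N : set R) : Prop :=
  forall eps : R, (0 < eps)%R -> exists I : nat -> interval R,
    N `<=` \bigcup_n [set` I n] /\ \sum_(n <oo) ilength (I n) < eps%:E.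

Definition almost_everywhere (R : realType) (P : R -> Prop) : Prop :=
  exists N : set R, null_set N /\ forall x, ~ N x -> P x.

Definition step_fun (R : realType) (m : nat) (c : 'I_m -> R)
    (I : 'I_m -> interval R) (x : R) : R :=
  (\sum_(i < m) c i * \1_[set` I i] x)%R.

Definition step_sum (R : realType) (m : nat) (c : 'I_m -> R)
    (I : 'I_m -> interval R) : R :=
  (\sum_(i < m) c i * fine (ilength (I i)))%R.

(* phi coincides a.e. with a step function having a representation whose
   associated sum is v. *)
Definition step_repr (R : realType) (phi : R -> \bar R) (v : R) : Prop :=
  exists (m : nat) (c : 'I_m -> R) (I : 'I_m -> interval R),
    [/\ forall i, bounded_set [set` I i],
        almost_everywhere (fun x => phi x = (step_fun c I x)%:E) &
        v = step_sum c I].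

(* Functions equal a.e. are identified by closing the class under a.e. equality
   rather than by a quotient. *)
Definition R0 (R : realType) : set (R -> \bar R) :=
  [set phi | exists v : R, step_repr phi v].
Arguments R0 : clear implicits.

(* The value does not depend on the chosen representation; the default value 0
   is used only outside R0. *)
Definition int0 (R : realType) (phi : R -> \bar R) : R :=
  xget 0%R [set v | step_repr phi v].

Definition ae_increases_to (R : realType) (phi : nat -> R -> \bar R)
    (f : R -> \bar R) : Prop :=
  (forall n, almost_everywhere (fun x => phi n x <= phi n.+1 x)) /\
  almost_everywhere (fun x => phi n x @[n --> \oo] --> f x).

Definition R0_approx (R : realType) (f : R -> \bar R)
    (phi : nat -> R -> \bar R) : Prop :=
  (forall n, R0 R (phi n)) /\ ae_increases_to phi f.

Definition R1 (R : realType) : set (R -> \bar R) :=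
  [set f | exists phi : nat -> R -> \bar R, R0_approx f phi].
Arguments R1 : clear implicits.

Definition lim_int0 (R : realType) (phi : nat -> R -> \bar R) : \bar R :=
  limn (fun n => (int0 (phi n))%:E).

(* The limit is taken along some chosen approximating sequence; the default
   sequence is used only outside R1. *)
Definition int1 (R : realType) (f : R -> \bar R) : \bar R :=
  lim_int0 (xget (fun _ _ => 0) [set phi | R0_approx f phi]).

(* Main.v *)
(* Null sets in the sense of interval covers are exactly the Lebesgue-negligible
   sets, so a step function has its Lebesgue integral as integral, and dominated
   convergence applies. All of (i)-(iii) rest on one comparison: if phi_n increases
   to f, psi_n increases to g and f <= g, then for fixed m the functions
   min(phi_m, psi_n) tend to phi_m, whence int phi_m <= lim int psi_n. For (iv),
   apply each operation termwise to approximating sequences; sums cause no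
   infinity clash because functions of R_1 and their integrals exceed -oo. *)
Require Import Defs.
From mathcomp Require Import ring lra measurable_realfun.
Set Implicit Arguments.
Unset Strict Implicit.
Unset Printing Implicit Defensive.
Local Open Scope classical_set_scope.
Local Open Scope ring_scope.
Local Open Scope ereal_scope.

Section Integral.
Variable R : realType.
Local Notation mu := (@lebesgue_measure R).

(** * Null sets and Lebesgue measure *)

#[local] Instance ae_lebesgue_filter :
  Filter (nbhs (measure_negligible.almost_everywhere mu)).
Proof. exact: ae_filter_ringOfSetsType. Qed.

Lemma lebesgue_measure_ilength (I : interval R) : mu [set` I] = ilength I.
Proof.
rewrite lebesgue_measure_itv /ilength wlength_itv.

by case: I => [[? ?|[]] [? ?|[]]].
Qed.

(** For each [k] take the union of a cover of total length below 1/(k+1); the intersection of these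
    unions is measurable, contains [N] and has measure zero. Conversely, small covers come from the
    definition of Lebesgue measure as an infimum over interval covers. *)
Lemma null_set_negligible (N : set R) : null_set N <-> mu.-negligible N.
Proof.
split=> [nN|[B [mB B0 NB]] e e0].
  have /choice[I HI] (k : nat) : exists I : nat -> interval R,
      N `<=` \bigcup_n [set` I n] /\
      \sum_(n <oo) ilength (I n) < (k.+1%:R^-1)%:E by exact: nN.
  pose B := \bigcap_k \bigcup_n [set` I k n].
  have mU k : measurable (\bigcup_n [set` I k n] : set R).
    by apply: bigcupT_measurable => n; exact: measurable_itv.
  have mB : measurable (B : set R) by exact: bigcapT_measurable.
  exists B; split=> //; last by move=> x Nx k _; apply: (HI k).1.
  have Bk k : mu B < (k.+1%:R^-1)%:E.
    apply: le_lt_trans (HI k).2.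
    under eq_eseriesr do rewrite -lebesgue_measure_ilength.
    apply: (@measure_sigma_subadditive _ _ _ mu B (fun n => [set` I k n])).
    - by move=> n; exact: measurable_itv.
    - exact: mB.
    - by move=> x; exact.
  apply/eqP; rewrite -measure_le0; apply/lee_addgt0Pr => e e0; rewrite add0e.
  (* With [k] the integer part of 1/e, k+1 exceeds 1/e, so 1/(k+1) is at most [e]. *)
  have /ltW := Bk (Num.truncn e^-1); move=> /le_trans; apply.
  by rewrite lee_fin invf_ple ?posrE// ltW// truncnS_gt.
have : mu B < e%:E by rewrite B0 lte_fin.
(* [mu B] unfolds to an infimum over countable covers by half-open intervals, so some cover already
   has total length below [e]. *)
move=> /ereal_inf_lt[_ [A [mA BA] <-] Ae].
have /choice[ab abE] n : exists ab : R * R, A n = [set` `]ab.1, ab.2]%R].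
  by have [ab _ <-] := mA n; exists ab.
exists (fun n => `](ab n).1, (ab n).2]%R); split.
  by apply: subset_trans NB (subset_trans BA _) => x [n _]; rewrite abE; exists n.
by under eq_eseriesr do rewrite /ilength -abE.
Qed.

Lemma almost_everywhereE (P : R -> Prop) :
  almost_everywhere P <-> {ae mu, forall x, P x}.
Proof.
split=> [[N [/null_set_negligible nN NP]]|nP].
  by apply: negligibleS nN => x /= nPx; apply: contrapT => /NP.
by exists (~` P); split; [exact/null_set_negligible|move=> x /contrapT].
Qed.


(** * The vector lattice of step functions *)

(** Equality holds everywhere and values are real, so closure properties reduce to pointwise
    identities; exceptional sets are left to [ae_step]. *)
Definition is_step (s : R -> R) : Prop :=
  exists (m : nat) (c : 'I_m -> R) (I : 'I_m -> interval R),
    (forall i, bounded_set [set` I i]) /\ s = step_fun c I.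

Lemma is_step0 : is_step (fun=> 0%R).
Proof.
exists 0%N, (fun=> 0%R), (fun=> `]0%R, 0%R]%R); split=> [[]//|].
by apply/funext => x; rewrite /step_fun big_ord0.
Qed.

Lemma is_step_indic (J : interval R) : bounded_set [set` J] -> is_step \1_[set` J].
Proof.
move=> bJ; exists 1%N, (fun=> 1%R), (fun=> J); split=> //.
by apply/funext => x; rewrite /step_fun big_ord1 mul1r.
Qed.

Lemma is_stepD (s t : R -> R) :
  is_step s -> is_step t -> is_step (fun x => s x + t x)%R.
Proof.
move=> [m [c [I [bI ->]]]] [n [d [J [bJ ->]]]].
exists (m + n)%N, (fun i : 'I_(m + n) => match fintype.split i with inl j => c j | inr k => d k end),
  (fun i : 'I_(m + n) => match fintype.split i with inl j => I j | inr k => J k end).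
split=> [i|]; first by case: (fintype.split i).
apply/funext => x; rewrite /step_fun big_split_ord/=.
by congr +%R; apply: eq_bigr => i _;
  [rewrite (unsplitK (inl i))|rewrite (unsplitK (inr i))].
Qed.

Lemma is_stepZ (a : R) (s : R -> R) : is_step s -> is_step (fun x => a * s x)%R.
Proof.
move=> [m [c [I [bI ->]]]]; exists m, (fun i => a * c i)%R, I; split=> //.
apply/funext => x; rewrite /step_fun mulr_sumr.
by under eq_bigr do rewrite mulrA.
Qed.

(** Multiplying by the indicator intersects every [I i] with [J], and the result stays bounded even
    if [J] is not. *)
Lemma is_step_indicM (J : interval R) (s : R -> R) :
  is_step s -> is_step (fun x => \1_[set` J] x * s x)%R.
Proof.
move=> [m [c [I [bI ->]]]]; exists m, c, (fun i => I i `&` J)%O; split=> [i|].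
  rewrite set_itvI; have [M [Mr HM]] := bI i; exists M; split=> // y /HM {}HM x [/HM]//.
apply/funext => x; rewrite /step_fun mulr_sumr; apply: eq_bigr => i _.
by rewrite set_itvI indicI /= mulrCA (mulrC (\1__ _)).
Qed.

(** Induction on the number of terms, splitting off the first; later arguments need not handle
    representations. *)
Lemma is_step_ind (P : (R -> R) -> Prop) :
  P (fun=> 0%R) ->
  (forall s a (J : interval R), bounded_set [set` J] -> is_step s -> P s ->
     P (fun x => s x + a * \1_[set` J] x)%R) ->
  forall s, is_step s -> P s.
Proof.
move=> P0 PD _ [m [c [I [bI ->]]]]; elim: m c I bI => [|m IH] c I bI.
  by rewrite (_ : step_fun c I = fun=> 0%R)//; apply/funext=> x; rewrite /step_fun big_ord0.
rewrite (_ : step_fun c I = fun x => step_fun (c \o lift ord0) (I \o lift ord0) x +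
    c ord0 * \1_[set` I ord0] x)%R; last first.
  by apply/funext => x; rewrite /step_fun big_ord_recl addrC.
apply: PD => //; last by apply: IH => i; exact: bI.
by exists m, (c \o lift ord0), (I \o lift ord0); split=> // i; exact: bI.
Qed.

(* Adding [a * \1_J] to [s] changes [h \o s] only on [J], where it becomes
   [h (s + a)]: this is why [h] is generalized in the induction. *)
Lemma is_step_comp (h : R -> R) (s : R -> R) :
  is_step s -> is_step (fun x => h (s x) - h 0)%R.
Proof.
move=> ss; move: s ss h; apply: is_step_ind => [h|s a J bJ ss IH h].
  by under eq_fun do rewrite subrr; exact: is_step0.
have IHa := IH (fun y => h (y + a)%R).
have -> : (fun x => h (s x + a * \1_[set` J] x) - h 0)%R =
  (fun x => (h (s x) - h 0) + (\1_[set` J] x * (h (s x + a) - h (0 + a)) +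
     ((h a - h 0) * \1_[set` J] x + (-1) * (\1_[set` J] x * (h (s x) - h 0)))))%R.
  apply/funext => x; rewrite indicE; case: (x \in _) => /=.
  by rewrite mulr1 add0r; ring.
  by rewrite mulr0 addr0; ring.
apply: is_stepD => //; apply: is_stepD; first exact: is_step_indicM.
apply: is_stepD; first by apply: is_stepZ; exact: is_step_indic.
by apply: is_stepZ; exact: is_step_indicM.
Qed.

(** The maximum is [t] plus the positive part of [s - t]. The positive part is a composition with a
    map fixing 0, so the constant subtracted in [is_step_comp] vanishes. *)
Lemma is_step_max (s t : R -> R) :
  is_step s -> is_step t -> is_step (fun x => Num.max (s x) (t x)).
Proof.
move=> ss st; have -> : (fun x => Num.max (s x) (t x)) =
    (fun x => t x + (Num.max (s x + (-1) * t x) 0 - Num.max 0 0))%R.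
  apply/funext => x; rewrite maxxx subr0 mulN1r addr_maxr addr0.
  by rewrite (addrC (t x)) subrK.
have sd : is_step (fun x => s x + (-1) * t x)%R by apply: is_stepD => //; exact: is_stepZ.
by apply: is_stepD => //; exact: (is_step_comp (fun y : R => Num.max y 0)%R sd).
Qed.

Lemma is_step_min (s t : R -> R) :
  is_step s -> is_step t -> is_step (fun x => Num.min (s x) (t x)).
Proof.
move=> ss st; have -> : (fun x => Num.min (s x) (t x)) =
    (fun x => (-1) * Num.max ((-1) * s x) ((-1) * t x))%R.
  by apply/funext => x; rewrite !mulN1r -oppr_min opprK.
by apply: is_stepZ; apply: is_step_max; exact: is_stepZ.
Qed.

(** * Lebesgue integrals of step functions *)

Lemma bounded_itv_lty (I : interval R) : bounded_set [set` I] -> ilength I < +oo.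
Proof.
move=> [M [Mr HM]]; rewrite -lebesgue_measure_ilength.
(* Boundedness gives the estimate only for constants strictly above [M], hence [M + 1]. *)
have IM : [set` I] `<=` [set` `[- (M + 1), M + 1]%R].
  by move=> x Ix; rewrite /= in_itv/= -ler_norml; apply: HM => //; rewrite ltrDl.
apply: (@le_lt_trans _ _ (mu [set` `[- (M + 1), M + 1]%R])).
  by apply: le_measure => //; rewrite inE; exact: measurable_itv.
by rewrite lebesgue_measure_itv/=; case: ifP => // _; rewrite -EFinB ltry.
Qed.

Lemma integrable_indic_itv (I : interval R) :
  bounded_set [set` I] -> mu.-integrable setT (fun x => (\1_[set` I] x)%:E).
Proof.
move=> bI; apply/integrableP; split.
  by apply/measurable_EFinP; exact: measurable_realfun.measurable_indic.
under eq_integral do rewrite gee0_abs ?lee_fin//.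
rewrite integral_indic ?setIT; [|exact: measurableT|exact: measurable_itv].
by rewrite [ltLHS]lebesgue_measure_ilength bounded_itv_lty.
Qed.

Lemma is_step_integrable (s : R -> R) : is_step s -> mu.-integrable setT (EFin \o s).
Proof.
move=> [m [c [I [bI ->]]]].
rewrite (_ : _ \o _ = fun x => \sum_(i < m) ((c i)%:E * (\1_[set` I i] x)%:E)); last first.
  by apply/funext => x; rewrite /step_fun/= -sumEFin.
apply: integrable_sum => // i _; apply: integrableZl => //.
exact: integrable_indic_itv.
Qed.

(** By linearity this is the measure of one interval at a time; boundedness makes each length
    finite, so [fine] loses nothing. *)
Lemma integral_step_fun (m : nat) (c : 'I_m -> R) (I : 'I_m -> interval R) :
  (forall i, bounded_set [set` I i]) ->
  \int[mu]_x (step_fun c I x)%:E = (step_sum c I)%:E.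
Proof.
move=> bI; rewrite /step_fun.
under eq_integral do rewrite -sumEFin.
rewrite integral_sum//; last first.
  by move=> i; under eq_fun do rewrite EFinM; apply: integrableZl => //; exact: integrable_indic_itv.
rewrite /step_sum -sumEFin; apply: eq_bigr => i _.
under eq_integral do rewrite EFinM.
rewrite integralZl//; last exact: integrable_indic_itv.
rewrite integral_indic ?setIT; [|exact: measurableT|exact: measurable_itv].
rewrite [X in _ * X]lebesgue_measure_ilength EFinM fineK//.
rewrite ge0_fin_numE ?bounded_itv_lty//.
Qed.


(** Replacing [s] by [min(s, t)], which equals it a.e., turns the a.e. inequality into one valid
    everywhere. *)
Lemma le_integral_step (s t : R -> R) : is_step s -> is_step t ->
  {ae mu, forall x, (s x <= t x)%R} ->
  \int[mu]_x (s x)%:E <= \int[mu]_x (t x)%:E.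
Proof.
move=> ss st st_le.
have -> : \int[mu]_x (s x)%:E = \int[mu]_x (Num.min (s x) (t x))%:E.
  apply: ae_eq_integral => //.
  - by have /integrableP[] := is_step_integrable ss.
  - by have /integrableP[] := is_step_integrable (is_step_min ss st).
  - by apply: filterS st_le => x stx _; rewrite min_l.
apply: le_integral => //.
- exact: is_step_integrable (is_step_min ss st).
- exact: is_step_integrable.
- by move=> x _; rewrite lee_fin ge_min lexx orbT.
Qed.

(** * The integral on $R_0$ *)

Definition ae_step (phi : R -> \bar R) (s : R -> R) : Prop :=
  is_step s /\ {ae mu, forall x, phi x = (s x)%:E}.

Lemma step_repr_ae (phi : R -> \bar R) (v : R) : step_repr phi v ->
  exists2 s, ae_step phi s & v%:E = \int[mu]_x (s x)%:E.
Proof.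
move=> [m [c [I [bI /almost_everywhereE phiE ->]]]].
exists (step_fun c I); last by rewrite integral_step_fun.
by split=> //; exists m, c, I.
Qed.

Lemma ae_step_repr (phi : R -> \bar R) (s : R -> R) :
  ae_step phi s -> exists v, step_repr phi v.
Proof.
move=> [[m [c [I [bI ->]]]] phiE]; exists (step_sum c I), m, c, I.
by split=> //; exact/almost_everywhereE.
Qed.

Lemma R0P (phi : R -> \bar R) : R0 R phi <-> exists s, ae_step phi s.
Proof.
split=> [[v /step_repr_ae[s]]|[s /ae_step_repr//]].
by exists s.
Qed.

(** Two step functions representing [phi] agree a.e., so monotonicity in both directions equates
    their integrals; whichever value [xget] selects is therefore the Lebesgue integral of [s]. *)
Lemma int0E (phi : R -> \bar R) (s : R -> R) :
  ae_step phi s -> (int0 phi)%:E = \int[mu]_x (s x)%:E.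
Proof.
move=> sphi; have /step_repr_ae[t [st tE] ->] : step_repr phi (int0 phi).
  exact: xgetPex (ae_step_repr sphi).
have [ss sE] := sphi.
by apply/eqP; rewrite eq_le; apply/andP; split; apply: le_integral_step => //;
  apply: filterS2 sE tE => x -> [->].
Qed.

Lemma le_int0 (phi psi : R -> \bar R) : R0 R phi -> R0 R psi ->
  {ae mu, forall x, phi x <= psi x} -> (int0 phi)%:E <= (int0 psi)%:E.
Proof.
move=> /R0P[s sphi] /R0P[t tpsi] le_phi_psi.
rewrite (int0E sphi) (int0E tpsi); apply: le_integral_step sphi.1 tpsi.1 _.
by apply: filterS3 sphi.2 tpsi.2 le_phi_psi => x -> ->; rewrite lee_fin.
Qed.

Lemma ae_stepD (phi psi : R -> \bar R) (s t : R -> R) :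
  ae_step phi s -> ae_step psi t ->
  ae_step (fun x => phi x + psi x) (fun x => s x + t x)%R.
Proof.
move=> [ss sE] [st tE]; split; first exact: is_stepD.
by apply: filterS2 sE tE => x -> ->.
Qed.

Lemma ae_stepZ (c : R) (phi : R -> \bar R) (s : R -> R) :
  ae_step phi s -> ae_step (fun x => c%:E * phi x) (fun x => c * s x)%R.
Proof.
move=> [ss sE]; split; first exact: is_stepZ.
by apply: filterS sE => x ->.
Qed.

Lemma ae_step_min (phi psi : R -> \bar R) (s t : R -> R) :
  ae_step phi s -> ae_step psi t ->
  ae_step (fun x => Order.min (phi x) (psi x)) (fun x => Num.min (s x) (t x)).
Proof.
move=> [ss sE] [st tE]; split; first exact: is_step_min.
by apply: filterS2 sE tE => x -> ->; rewrite EFin_min.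
Qed.

Lemma ae_step_max (phi psi : R -> \bar R) (s t : R -> R) :
  ae_step phi s -> ae_step psi t ->
  ae_step (fun x => Order.max (phi x) (psi x)) (fun x => Num.max (s x) (t x)).
Proof.
move=> [ss sE] [st tE]; split; first exact: is_step_max.
by apply: filterS2 sE tE => x -> ->; rewrite EFin_max.
Qed.

Lemma int0D (phi psi : R -> \bar R) : R0 R phi -> R0 R psi ->
  (int0 (fun x => phi x + psi x)%E)%:E = (int0 phi)%:E + (int0 psi)%:E.
Proof.
move=> /R0P[s sphi] /R0P[t tpsi].
rewrite (int0E (ae_stepD sphi tpsi)) (int0E sphi) (int0E tpsi).
under eq_integral do rewrite EFinD.
by rewrite integralD//; apply: is_step_integrable; [case: sphi|case: tpsi].
Qed.

Lemma int0Z (c : R) (phi : R -> \bar R) : R0 R phi ->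
  (int0 (fun x => c%:E * phi x)%E)%:E = c%:E * (int0 phi)%:E.
Proof.
move=> /R0P[s sphi]; rewrite (int0E (ae_stepZ c sphi)) (int0E sphi).
under eq_integral do rewrite EFinM.
by rewrite integralZl//; apply: is_step_integrable; case: sphi.
Qed.

(** * Approximating sequences and the comparison of limits *)

(** A countable union of null sets is null, so the conditions for all [n] hold together off a single
    null set, where everything becomes a statement about one increasing real sequence. *)
Lemma R0_approx_steps (f : R -> \bar R) (phi : nat -> R -> \bar R) :
  R0_approx f phi -> exists s : nat -> R -> R,
    (forall n, ae_step (phi n) (s n)) /\
    {ae mu, forall x, [/\ forall n, phi n x = (s n x)%:E,
      {homo s ^~ x : m n / (m <= n)%N >-> (m <= n)%R} &
      (s n x)%:E @[n --> \oo] --> f x]}.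
Proof.
move=> [/[dup] R0phi /(fun h n => (R0P (phi n)).1 (h n))/choice[s sphi] [phi_le phi_f]].
exists s; split=> //.
have s_eq := ae_foralln (fun n => (sphi n).2).
have {}phi_le := ae_foralln (fun n => (almost_everywhereE _).1 (phi_le n)).
move/almost_everywhereE : phi_f => phi_f.
apply: filterS3 s_eq phi_le phi_f => x s_eq phi_le phi_f; split=> //.
  by apply/nondecreasing_seqP => n; rewrite -lee_fin -!s_eq.
by under eq_cvg do rewrite -s_eq.
Qed.

Lemma R0_approx_nondecreasing (f : R -> \bar R) (phi : nat -> R -> \bar R) :
  R0_approx f phi -> nondecreasing_seq (fun n => (int0 (phi n))%:E).
Proof.
move=> [R0phi [phi_le _]]; apply/nondecreasing_seqP => n.
by apply: le_int0 => //; exact/almost_everywhereE.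
Qed.

Lemma R0_approx_cvg (f : R -> \bar R) (phi : nat -> R -> \bar R) :
  R0_approx f phi -> cvgn (fun n => (int0 (phi n))%:E).
Proof. by move=> /R0_approx_nondecreasing/ereal_nondecreasing_is_cvgn. Qed.

(** The integrals increase from a finite value at index 0. This makes the sum of two such limits
    well defined. *)
Lemma lim_int0_gtNy (f : R -> \bar R) (phi : nat -> R -> \bar R) :
  R0_approx f phi -> -oo < lim_int0 phi.
Proof.
move=> /R0_approx_nondecreasing/ereal_nondecreasing_cvgn/cvg_lim.
rewrite /lim_int0 => -> //; apply: (@lt_le_trans _ _ (int0 (phi 0%N))%:E).
  exact: ltNyr.
by apply: ereal_sup_ubound; exists 0%N.
Qed.

Lemma cvge_min (u v : nat -> \bar R) (a b : \bar R) :
  u n @[n --> \oo] --> a -> v n @[n --> \oo] --> b ->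
  Order.min (u n) (v n) @[n --> \oo] --> Order.min a b.
Proof.
apply: (@continuous2_cvg _ _ _ _ _ _ _ _ Order.min).
exact: (@min_continuous _ (\bar R) (a, b)).
Qed.

Lemma cvge_max (u v : nat -> \bar R) (a b : \bar R) :
  u n @[n --> \oo] --> a -> v n @[n --> \oo] --> b ->
  Order.max (u n) (v n) @[n --> \oo] --> Order.max a b.
Proof.
apply: (@continuous2_cvg _ _ _ _ _ _ _ _ Order.max).
exact: (@max_continuous _ (\bar R) (a, b)).
Qed.

Lemma le_nondecreasing_EFin_cvg (u : nat -> R) (l : \bar R) (m : nat) :
  {homo u : i j / (i <= j)%N >-> (i <= j)%R} ->
  (u n)%:E @[n --> \oo] --> l -> (u m)%:E <= l.
Proof.
move=> u_nd u_l; rewrite -(cvg_lim _ u_l)//.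
apply: lime_ge; first by apply/cvg_ex; exists l.
by exists m => // n /= mn; rewrite lee_fin u_nd.
Qed.

(* [min (s m) (t n)] is dominated by [|s m| + |t 0|]. *)
Lemma le_lim_int0 (f g : R -> \bar R) (phi psi : nat -> R -> \bar R) :
  R0_approx f phi -> R0_approx g psi -> {ae mu, forall x, f x <= g x} ->
  lim_int0 phi <= lim_int0 psi.
Proof.
move=> /[dup] Aphi /R0_approx_steps[s [sphi s_f]].
move=> /[dup] Apsi /R0_approx_steps[t [tpsi t_g]] fg.
apply: lime_le; first exact: R0_approx_cvg Aphi.
apply: nearW => m; rewrite (int0E (sphi m)).
have ss := (sphi m).1; have st n := (tpsi n).1.
have mstep u : is_step u -> measurable_fun setT (EFin \o u).
  by move=> /is_step_integrable/integrableP[].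
have [] := @dominated_convergence _ _ _ mu setT measurableT
  (fun n x => (Num.min (s m x) (t n x))%:E) (fun x => (s m x)%:E)
  (fun x => `|(s m x)%:E| + `|(t 0%N x)%:E|).
- by move=> n; apply: mstep; exact: is_step_min.
- exact: mstep.
- apply: filterS3 s_f t_g fg => x [_ s_nd s_f] [_ t_nd t_g] fgx _.
  under eq_cvg do rewrite EFin_min.
  have le_sg : (s m x)%:E <= g x.
    exact: le_trans (le_nondecreasing_EFin_cvg m s_nd s_f) fgx.
  suff : Order.min (s m x)%:E (t n x)%:E @[n --> \oo] --> Order.min (s m x)%:E (g x).
    by rewrite (min_l le_sg).
  by apply: cvge_min => //; exact: cvg_cst.
- by apply: integrableD => //; apply: integrable_abse; exact: is_step_integrable.
- apply: filterS t_g => x [_ t_nd _] n _; rewrite -EFinD lee_fin.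
  have t0n := t_nd 0%N n (leq0n n).
  have ns0 := normr_ge0 (s m x); have nt0 := normr_ge0 (t 0%N x).
  have /andP[sl sr] : (- `|s m x| <= s m x <= `|s m x|)%R by rewrite -ler_norml.
  have /andP[tl tr] : (- `|t 0%N x| <= t 0%N x <= `|t 0%N x|)%R by rewrite -ler_norml.
  rewrite ler_norml le_min ge_min; apply/andP; split; last by apply/orP; left; lra.
  by apply/andP; split; lra.
(* Dominated convergence writes the integral of [s m] as the limit of those of [min(s m, t n)], each
   bounded by the integral of [t n]. *)
move=> _ _ cvg_min; rewrite -(cvg_lim _ cvg_min)//.
apply: lee_lim; [by apply/cvg_ex; eexists; exact: cvg_min|exact: R0_approx_cvg Apsi|].
apply: nearW => n; rewrite (int0E (tpsi n)); apply: le_integral_step => //.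
  exact: is_step_min.
by apply: aeW => x; rewrite ge_min lexx orbT.
Qed.

Lemma lim_int0_unique (f : R -> \bar R) (phi psi : nat -> R -> \bar R) :
  R0_approx f phi -> R0_approx f psi -> lim_int0 phi = lim_int0 psi.
Proof.
move=> Aphi Apsi; have ff : {ae mu, forall x, f x <= f x} by exact: aeW.
by apply/eqP; rewrite eq_le (le_lim_int0 Aphi Apsi ff) (le_lim_int0 Apsi Aphi ff).
Qed.

(** The existence of [phi] guarantees that the sequence picked by [xget] is approximating, and
    uniqueness of the limit allows exchanging it for [phi]. *)
Lemma int1E (f : R -> \bar R) (phi : nat -> R -> \bar R) :
  R0_approx f phi -> int1 f = lim_int0 phi.
Proof.
move=> Aphi; apply: (lim_int0_unique _ Aphi).
by apply: (@xgetPex _ _ [set phi | R0_approx f phi]); exists phi.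
Qed.

Lemma R0_approx_cst (phi : R -> \bar R) : R0 R phi -> R0_approx phi (fun=> phi).
Proof.
move=> R0phi; split=> //; split=> [n|]; apply/almost_everywhereE; apply: aeW => x //.
exact: cvg_cst.
Qed.

(** * Termwise operations on approximating sequences *)

(** Common pattern behind all four operations of (iv). Continuity of [F] is asked only at limits
    above [-oo], which is what lets addition qualify. *)
Lemma R0_approx2 (F : \bar R -> \bar R -> \bar R) (Fr : R -> R -> R)
  (f g : R -> \bar R) (phi psi : nat -> R -> \bar R) :
  (forall phi psi s t, ae_step phi s -> ae_step psi t ->
     ae_step (fun x => F (phi x) (psi x)) (fun x => Fr (s x) (t x))) ->
  (forall a b, F a%:E b%:E = (Fr a b)%:E) ->
  (forall a a' b b', a <= a' -> b <= b' -> Fr a b <= Fr a' b')%R ->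
  (forall (u v : nat -> \bar R) a b, -oo < a -> -oo < b ->
     u n @[n --> \oo] --> a -> v n @[n --> \oo] --> b ->
     F (u n) (v n) @[n --> \oo] --> F a b) ->
  R0_approx f phi -> R0_approx g psi ->
  R0_approx (fun x => F (f x) (g x)) (fun n x => F (phi n x) (psi n x)).
Proof.
move=> F_step FE F_le F_cvg /R0_approx_steps[s [sphi s_f]] /R0_approx_steps[t [tpsi t_g]].
split=> [n|]; first by apply/R0P; eexists; exact: F_step (sphi n) (tpsi n).
split=> [n|]; apply/almost_everywhereE; apply: filterS2 s_f t_g.
  move=> x [s_eq s_nd _] [t_eq t_nd _].
  by rewrite !s_eq !t_eq !FE lee_fin F_le// ?s_nd ?t_nd.
move=> x [s_eq s_nd s_f] [t_eq t_nd t_g].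
under eq_cvg do rewrite s_eq t_eq.
(* Each pointwise limit is at least the real value at index 0, hence above [-oo]. *)
apply: F_cvg => //.
  exact: lt_le_trans (ltNyr _) (le_nondecreasing_EFin_cvg 0 s_nd s_f).
exact: lt_le_trans (ltNyr _) (le_nondecreasing_EFin_cvg 0 t_nd t_g).
Qed.

Lemma R0_approxD (f g : R -> \bar R) (phi psi : nat -> R -> \bar R) :
  R0_approx f phi -> R0_approx g psi ->
  R0_approx (fun x => f x + g x) (fun n x => phi n x + psi n x).
Proof.
apply: (R0_approx2 (F := fun a b => a + b) (Fr := fun a b => a + b)%R) => //.
- exact: ae_stepD.
- by move=> a a' b b'; exact: lerD.
- by move=> u v a b aNy bNy; apply: cvgeD; apply: ltninfty_adde_def.
Qed.

(** Scaling is treated as a binary operation ignoring its second argument. For [c = 0] the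
    convention that 0 times infinity is 0 makes the limit function 0, like every term. *)
Lemma R0_approxZ (c : R) (f : R -> \bar R) (phi : nat -> R -> \bar R) : (0 <= c)%R ->
  R0_approx f phi -> R0_approx (fun x => c%:E * f x) (fun n x => c%:E * phi n x).
Proof.
move=> c0 Aphi; apply: (@R0_approx2 (fun a _ => c%:E * a) (fun a _ => c * a)%R
  f f phi phi) => //.
- by move=> p _ s _ sp _; exact: ae_stepZ.
- by move=> a a' _ _ aa' _; exact: ler_wpM2l.
- by move=> u _ a _ _ _ ua _; exact: cvgeZl.
Qed.

Lemma R0_approx_min (f g : R -> \bar R) (phi psi : nat -> R -> \bar R) :
  R0_approx f phi -> R0_approx g psi ->
  R0_approx (fun x => Order.min (f x) (g x)) (fun n x => Order.min (phi n x) (psi n x)).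
Proof.
apply: (R0_approx2 (F := Order.min) (Fr := Num.min)).
- exact: ae_step_min.
- by move=> a b; rewrite EFin_min.
- by move=> a a' b b' aa' bb'; rewrite le_min !ge_min aa' bb' orbT.
- by move=> u v a b _ _; exact: cvge_min.
Qed.

Lemma R0_approx_max (f g : R -> \bar R) (phi psi : nat -> R -> \bar R) :
  R0_approx f phi -> R0_approx g psi ->
  R0_approx (fun x => Order.max (f x) (g x)) (fun n x => Order.max (phi n x) (psi n x)).
Proof.
apply: (R0_approx2 (F := Order.max) (Fr := Num.max)).
- exact: ae_step_max.
- by move=> a b; rewrite EFin_max.
- by move=> a a' b b' aa' bb'; rewrite ge_max !le_max aa' bb' orbT.
- by move=> u v a b _ _; exact: cvge_max.
Qed.

End Integral.

Theorem proposition3p1 (R : realType) :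
  [/\ (* (i) the limit exists and is the same for all approximating sequences *)
      forall (f : R -> \bar R) (phi psi : nat -> R -> \bar R),
        R0_approx f phi -> R0_approx f psi ->
        cvgn (fun n => (int0 (phi n))%:E) /\ lim_int0 phi = lim_int0 psi,
      (* (ii) *)
      forall phi : R -> \bar R, R0 R phi ->
        R1 R phi /\ int1 phi = (int0 phi)%:E,
      (* (iii) *)
      forall f g : R -> \bar R, R1 R f -> R1 R g ->
        almost_everywhere (fun x => f x <= g x) -> int1 f <= int1 g
    & (* (iv) *)
      forall (f g : R -> \bar R) (c : R), R1 R f -> R1 R g -> (0 <= c)%R ->
        [/\ R1 R (fun x => c%:E * f x),
            R1 R (fun x => f x + g x),
            R1 R (fun x => Order.min (f x) (g x)),
            R1 R (fun x => Order.max (f x) (g x))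
          & int1 (fun x => c%:E * f x) = c%:E * int1 f /\
            int1 (fun x => f x + g x) = int1 f + int1 g]].
Proof.
split.
- move=> f phi psi Aphi Apsi.
  by split; [exact: R0_approx_cvg Aphi|exact: lim_int0_unique Aphi Apsi].
- move=> phi /R0_approx_cst Aphi; split; first by exists (fun=> phi).
  by rewrite (int1E Aphi) /lim_int0 lim_cst.
- move=> f g [phi Aphi] [psi Apsi] /almost_everywhereE fg.
  by rewrite (int1E Aphi) (int1E Apsi); exact: le_lim_int0 Aphi Apsi fg.
- move=> f g c [phi Aphi] [psi Apsi] c0; split.
  + by eexists; exact: R0_approxZ Aphi.
  + by eexists; exact: R0_approxD Aphi Apsi.
  + by eexists; exact: R0_approx_min Aphi Apsi.
  + by eexists; exact: R0_approx_max Aphi Apsi.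
  + have cvg_phi := R0_approx_cvg Aphi; have cvg_psi := R0_approx_cvg Apsi.
    rewrite (int1E Aphi) (int1E Apsi) (int1E (R0_approxZ c0 Aphi)).
    rewrite (int1E (R0_approxD Aphi Apsi)); split.
      (* Multiplication by the finite constant [c] preserves convergence even when the limit is
         [+oo]. *)
      apply/cvg_lim => //; under eq_cvg do rewrite (int0Z _ (Aphi.1 _)).
      exact: cvgeZl.
    apply/cvg_lim => //; under eq_cvg do rewrite (int0D (Aphi.1 _) (Apsi.1 _)).
    apply: cvgeD => //.
    by apply: ltninfty_adde_def; [exact: lim_int0_gtNy Aphi|exact: lim_int0_gtNy Apsi].
Qed.
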